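(* Let $\mathbb{G}=(\Gamma,\mathcal{G})$ be a graph of groups. Let $\Gamma'\subset\Gamma$ be a nontrivial (connected) subgraph containing at least one edge, let $v\in V(\Gamma')$, and let $\mathbb{G}'=(\Gamma',\mathcal{G})$ be the restricted graph of groups. Suppose $\pi_1(\mathbb{G}',v)\curvearrowright X_{\mathbb{G}'}$ is strongly faithful. Then $\pi_1(\mathbb{G},v)\curvearrowright X_{\mathbb{G}}$ is also strongly faithful.
   Context: A graph $\Gamma$ has a vertex set $V(\Gamma)$, a set $E(\Gamma)$ of oriented edges, maps $o,t:E(\Gamma)\to V(\Gamma)$ and an involution $e\mapsto\bar e$ with $\bar e\ne e$ and $o(e)=t(\bar e)$. A graph of groups $\mathbb{G}=(\Gamma,\mathcal{G})$ is a connected graph $\Gamma$ with vertex groups $G_v$, edge groups $G_e=G_{\bar e}$, and monomorphisms $\alpha_e:G_e\hookrightarrow G_{o(e)}$; $\Gamma$ is countable and all groups are countable discrete. The restriction of $\mathbb{G}$ to a subgraph $\Gamma'$ keeps the groups and monomorphisms attached to vertices and edges of $\Gamma'$. The path group $F(\mathbb{G})$ is generated by all $G_v$ and all $e\in E(\Gamma)$ subject to $\bar e=e^{-1}$ and $\bar e\,\alpha_e(g)\,e=\alpha_{\bar e}(g)$ for $g\in G_e$. $\pi[v,u]\subset F(\mathbb{G})$ is the set of elements $g_1e_1\cdots g_ne_ng_{n+1}$ ($n\ge 0$) with $(e_1,\dots,e_n)$ an edge path from $v$ to $u$, $g_i\in G_{o(e_i)}$, $g_{n+1}\in G_u$; $\pi_1(\mathbb{G},v)=\pi[v,v]$.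 The Bass–Serre tree $X_{\mathbb{G}}$ has vertices the cosets $\gamma G_u$, $\gamma\in\pi[v,u]$, $u\in V(\Gamma)$; $\gamma_1G_{u_1}$, $\gamma_2G_{u_2}$ are joined by an edge iff $\gamma_1^{-1}\gamma_2\in G_{u_1}eG_{u_2}$ for some $e$ with $o(e)=u_1$, $t(e)=u_2$; $\pi_1(\mathbb{G},v)$ acts by left multiplication. An action $G\curvearrowright S$ on a set $S$ is strongly faithful if for any finite $F\subset G\setminus\{1_G\}$ there is $x\in S$ with $g\cdot x\ne x$ for all $g\in F$. For an action on a tree, $S$ is the vertex set. *)

(* Defs.v *)
From HB Require Import structures.
From mathcomp Require Import all_boot generic_quotient.
From mathcomp Require Import boolp classical_sets functions cardinality.

Set Implicit Arguments.
Unset Strict Implicit.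
Unset Printing Implicit Defensive.

Local Open Scope classical_set_scope.
Local Open Scope quotient_scope.
Local Open Scope group_scope.

Record graph := Graph {
  vertex : Type;
  edge : Type;
  org : edge -> vertex;
  trg : edge -> vertex;
  bar : edge -> edge;
  barK : forall e, bar (bar e) = e;
  bar_neq : forall e, bar e <> e;
  org_bar : forall e, org e = trg (bar e)
}.

Fixpoint edge_path (Gam : graph) (v : vertex Gam) (p : seq (edge Gam))
    (u : vertex Gam) : Prop :=
  if p is e :: p' then org e = v /\ edge_path (trg e) p' u else v = u.

Definition connected (Gam : graph) :=
  forall v u : vertex Gam, exists p, edge_path v p u.

Record subgraph (Gam : graph) := Subgraph {
  sub_vertex : set (vertex Gam);
  sub_edge : set (edge Gam);
  sub_org : forall e, sub_edge e -> sub_vertex (org e);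
  sub_trg : forall e, sub_edge e -> sub_vertex (trg e);
  sub_bar : forall e, sub_edge e -> sub_edge (bar e)
}.

Lemma sig_inj (T : Type) (P : T -> Prop) (x y : {z | P z}) :
  sval x = sval y -> x = y.
Proof. by case: x y => [x Px] [y Py] /= xy; exact: eq_exist. Qed.

Section SubgraphGraph.
Variables (Gam : graph) (S : subgraph Gam).

Definition sg_vertex := {v | sub_vertex S v}.
Definition sg_edge := {e | sub_edge S e}.
Definition sg_org (e : sg_edge) : sg_vertex :=
  exist _ (org (sval e)) (sub_org (svalP e)).
Definition sg_trg (e : sg_edge) : sg_vertex :=
  exist _ (trg (sval e)) (sub_trg (svalP e)).
Definition sg_bar (e : sg_edge) : sg_edge :=
  exist _ (bar (sval e)) (sub_bar (svalP e)).

Lemma sg_barK e : sg_bar (sg_bar e) = e.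
Proof. exact/sig_inj/barK. Qed.

Lemma sg_bar_neq e : sg_bar e <> e.
Proof. by move=> /(congr1 sval)/=; exact: bar_neq. Qed.

Lemma sg_org_bar e : sg_org e = sg_trg (sg_bar e).
Proof. exact/sig_inj/org_bar. Qed.

Definition graph_of_subgraph : graph := Graph sg_barK sg_bar_neq sg_org_bar.

End SubgraphGraph.
Coercion graph_of_subgraph : subgraph >-> graph.

(* [edge_group_bar] is the identity G_e = G_(bar e); [edge_cast] transports
   elements of G_e along it. *)
Record graph_of_groups (Gam : graph) := GraphOfGroups {
  gog_connected : connected Gam;
  countable_vertex : countable [set: vertex Gam];
  countable_edge : countable [set: edge Gam];
  vertex_group : vertex Gam -> groupType;
  edge_group : edge Gam -> groupType;
  countable_vertex_group : forall v, countable [set: vertex_group v];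
  countable_edge_group : forall e, countable [set: edge_group e];
  edge_group_bar : forall e, edge_group e = edge_group (bar e);
  alpha : forall e, {multiplicative edge_group e -> vertex_group (org e)};
  alpha_inj : forall e, injective (alpha e)
}.

Definition edge_cast (Gam : graph) (GG : graph_of_groups Gam) (e : edge Gam)
    (g : edge_group GG e) : edge_group GG (bar e) :=
  eq_rect _ (fun H : groupType => H : Type) g _ (edge_group_bar GG e).

Section Restriction.
Variables (Gam : graph) (GG : graph_of_groups Gam) (S : subgraph Gam).
Hypothesis cS : connected S.

Lemma countable_sig (T : Type) (P : T -> Prop) :
  countable [set: T] -> countable [set: {x | P x}].
Proof.
move=> /countable_injP[f f_inj]; apply/countable_injP.
exists (f \o sval) => x y _ _ /= fxy.
by apply/sig_inj/f_inj; rewrite ?in_setE.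
Qed.

Definition restrict : graph_of_groups S :=
  @GraphOfGroups S cS
    (countable_sig _ (countable_vertex GG))
    (countable_sig _ (countable_edge GG))
    (fun v => vertex_group GG (sval v)) (fun e => edge_group GG (sval e))
    (fun v => countable_vertex_group GG (sval v))
    (fun e => countable_edge_group GG (sval e))
    (fun e => edge_group_bar GG (sval e))
    (fun e => alpha GG (sval e)) (fun e => @alpha_inj _ GG (sval e)).

End Restriction.

(* The group presented by generators and relations: formal group expressions
   in the generators, modulo the smallest congruence containing the group
   axioms and the relations.  "Generated by all G_v" includes the relations of
   each G_v, which is [pg_vertexM]. *)
Section PathGroup.
Variables (Gam : graph) (GG : graph_of_groups Gam).

Inductive pg_expr :=
  | PgVertex (v : vertex Gam) of vertex_group GG v
  | PgEdge of edge Gam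
  | PgOne
  | PgMul of pg_expr & pg_expr
  | PgInv of pg_expr.

Inductive pg_rel : pg_expr -> pg_expr -> Prop :=
  | pg_refl x : pg_rel x x
  | pg_sym x y : pg_rel x y -> pg_rel y x
  | pg_trans y x z : pg_rel x y -> pg_rel y z -> pg_rel x z
  | pg_congM x x' y y' :
      pg_rel x x' -> pg_rel y y' -> pg_rel (PgMul x y) (PgMul x' y')
  | pg_congV x x' : pg_rel x x' -> pg_rel (PgInv x) (PgInv x')
  | pg_mulA x y z : pg_rel (PgMul x (PgMul y z)) (PgMul (PgMul x y) z)
  | pg_mul1 x : pg_rel (PgMul PgOne x) x
  | pg_mulx1 x : pg_rel (PgMul x PgOne) x
  | pg_mulV x : pg_rel (PgMul (PgInv x) x) PgOne
  | pg_mulxV x : pg_rel (PgMul x (PgInv x)) PgOne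
  | pg_vertexM v (g h : vertex_group GG v) :
      pg_rel (PgVertex (g * h)) (PgMul (PgVertex g) (PgVertex h))
  | pg_bar e : pg_rel (PgEdge (bar e)) (PgInv (PgEdge e))
  | pg_edge e (g : edge_group GG e) :
      pg_rel (PgMul (PgMul (PgEdge (bar e)) (PgVertex (alpha GG e g)))
                    (PgEdge e))
             (PgVertex (alpha GG (bar e) (edge_cast g))).

HB.instance Definition _ := gen_eqMixin pg_expr.
HB.instance Definition _ := gen_choiceMixin pg_expr.

Definition pgb : rel pg_expr := fun x y => `[< pg_rel x y >].

Lemma pgb_refl : reflexive pgb.
Proof. by move=> x; apply/asboolP/pg_refl. Qed.

Lemma pgb_sym : symmetric pgb.
Proof. by move=> x y; apply/asboolP/asboolP => /pg_sym. Qed.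

Lemma pgb_trans : transitive pgb.
Proof.
by move=> y x z /asboolP xy /asboolP yz; apply/asboolP; exact: pg_trans yz.
Qed.

Definition pg_equiv : equiv_rel pg_expr :=
  EquivRel pgb pgb_refl pgb_sym pgb_trans.

Definition path_group := {eq_quot pg_equiv}.

HB.instance Definition _ := Choice.on path_group.

Definition pg_class (x : pg_expr) : path_group := \pi_path_group x.

Lemma pg_classP x y : pg_class x = pg_class y <-> pg_rel x y.
Proof.
split=> [/eqP|xy]; first by rewrite /pg_class eqmodE => /asboolP.
by apply/eqP; rewrite /pg_class eqmodE; apply/asboolP.
Qed.

Lemma pg_reprK (x : path_group) : pg_class (repr x) = x.
Proof. exact: reprK. Qed.

Lemma pg_repr x : pg_rel (repr (pg_class x)) x.
Proof. by apply/pg_classP; rewrite pg_reprK. Qed.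

Definition pg_one : path_group := pg_class PgOne.
Definition pg_mul (x y : path_group) : path_group :=
  pg_class (PgMul (repr x) (repr y)).
Definition pg_inv (x : path_group) : path_group := pg_class (PgInv (repr x)).

Lemma pg_mulE x y : pg_mul (pg_class x) (pg_class y) = pg_class (PgMul x y).
Proof. by apply/pg_classP; apply: pg_congM; exact: pg_repr. Qed.

Lemma pg_invE x : pg_inv (pg_class x) = pg_class (PgInv x).
Proof. by apply/pg_classP; apply: pg_congV; exact: pg_repr. Qed.

Lemma pg_groupA : associative pg_mul.
Proof.
move=> x y z; rewrite -(pg_reprK x) -(pg_reprK y) -(pg_reprK z) !pg_mulE.
exact/pg_classP/pg_mulA.
Qed.

Lemma pg_group1 : left_id pg_one pg_mul.
Proof. by move=> x; rewrite -(pg_reprK x) pg_mulE; exact/pg_classP/pg_mul1. Qed.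

Lemma pg_groupx1 : right_id pg_one pg_mul.
Proof. by move=> x; rewrite -(pg_reprK x) pg_mulE; exact/pg_classP/pg_mulx1. Qed.

Lemma pg_groupV : left_inverse pg_one pg_inv pg_mul.
Proof.
by move=> x; rewrite -(pg_reprK x) pg_invE pg_mulE; exact/pg_classP/pg_mulV.
Qed.

Lemma pg_groupxV : right_inverse pg_one pg_inv pg_mul.
Proof.
by move=> x; rewrite -(pg_reprK x) pg_invE pg_mulE; exact/pg_classP/pg_mulxV.
Qed.

HB.instance Definition _ := isGroup.Build path_group
  pg_groupA pg_group1 pg_groupx1 pg_groupV pg_groupxV.

Definition pg_v (v : vertex Gam) (g : vertex_group GG v) : path_group :=
  pg_class (PgVertex g).
Definition pg_e (e : edge Gam) : path_group := pg_class (PgEdge e).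

Lemma pg_vM v (g h : vertex_group GG v) : pg_v (g * h) = pg_v g * pg_v h.
Proof. by rewrite [RHS]pg_mulE; exact/pg_classP/pg_vertexM. Qed.

Lemma pg_v1 v : pg_v (1 : vertex_group GG v) = 1.
Proof. by apply: (@mulgI _ (pg_v (1 : vertex_group GG v))); rewrite -pg_vM !mulg1. Qed.

Lemma pg_e_bar e : pg_e (bar e) = (pg_e e)^-1.
Proof. by rewrite [RHS]pg_invE; exact/pg_classP/pg_bar. Qed.

Lemma pg_e_alpha e (g : edge_group GG e) :
  pg_e (bar e) * pg_v (alpha GG e g) * pg_e e =
  pg_v (alpha GG (bar e) (edge_cast g)).
Proof.
rewrite -[LHS]/(pg_mul (pg_mul (pg_e _) (pg_v _)) (pg_e _)).
rewrite /pg_e /pg_v !pg_mulE; exact/pg_classP/pg_edge.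
Qed.

Definition decorated := seq {e : edge Gam & vertex_group GG (org e)}.

Definition decorate (e : edge Gam) (g : vertex_group GG (org e)) :
  {e : edge Gam & vertex_group GG (org e)} := existT _ e g.

Definition path_prod (p : decorated) : path_group :=
  \prod_(x <- p) (pg_v (tagged x) * pg_e (tag x)).

(* pi[v, u] *)
Definition path_set (v u : vertex Gam) : set path_group :=
  [set x | exists (p : decorated) (g : vertex_group GG u),
     edge_path v (map tag p) u /\ x = path_prod p * pg_v g].

Lemma path_set_v v (g : vertex_group GG v) : path_set v v (pg_v g).
Proof. by exists [::], g; split=> //; rewrite /path_prod big_nil mul1g. Qed.

Lemma path_set_e e : path_set (org e) (trg e) (pg_e e).
Proof.
exists [:: decorate (1 : vertex_group GG (org e))], 1; split=> //.
by rewrite /path_prod big_seq1 /= !pg_v1 mulg1 mul1g.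
Qed.

Lemma path_setM u v w x y :
  path_set v u x -> path_set u w y -> path_set v w (x * y).
Proof.
case=> p [g [pP ->]]; move: v g pP.
have base v (g : vertex_group GG v) :
    path_set v w y -> path_set v w (pg_v g * y).
  case=> -[|[e h] q] [k [/= qP ->]].
    rewrite qP in g *; exists [::], (g * k).
    by split=> //; rewrite /path_prod big_nil !mul1g pg_vM.
  case: qP => ev qP; case: v / ev g => g.
  exists (decorate (g * h) :: q), k; split=> //.
  by rewrite /path_prod !big_cons /= pg_vM !mulgA.
elim: p => [|[e h] p IH] v g /=.
  by move=> -> yP; rewrite /path_prod big_nil mul1g; exact: base.
case=> <- pP yP; have [q [k [qP E]]] := IH _ g pP yP.
exists (decorate h :: q), k; split=> //.
by rewrite /path_prod !big_cons /= -!mulgA; congr (_ * (_ * _)); rewrite mulgA.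
Qed.

Lemma path_setV u v x : path_set v u x -> path_set u v x^-1.
Proof.
case=> p [g [pP ->]]; move: v g pP; elim: p => [|[e h] p IH] v g /=.
  move=> ->; rewrite /path_prod big_nil mul1g.
  have -> : (pg_v g)^-1 = pg_v g^-1.
    by apply: (@mulgI _ (pg_v g)); rewrite mulgV -pg_vM mulgV pg_v1.
  exact: path_set_v.
case=> <- /(IH _ g) IHp; rewrite /path_prod big_cons /= -mulgA invgM.
apply: path_setM IHp _; rewrite invgM -pg_e_bar.
have -> : (pg_v h)^-1 = pg_v h^-1.
  by apply: (@mulgI _ (pg_v h)); rewrite mulgV -pg_vM mulgV pg_v1.
apply: path_setM (path_set_v _).
by have := path_set_e (bar e); rewrite -(org_bar e) org_bar barK.
Qed.

Definition pi1 (v : vertex Gam) := {x : path_group | x \in path_set v v}.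

HB.instance Definition _ v := SubChoice.on (pi1 v).

Lemma pi1_closed v : group_closed (mem (path_set v v)).
Proof.
split=> [|x y].
  by apply/mem_set; rewrite -(pg_v1 v); exact: path_set_v.
by rewrite !in_setE => xP yP; apply: path_setM xP (path_setV yP).
Qed.

HB.instance Definition _ v := SubChoice_isSubGroup.Build path_group
  (mem (path_set v v)) (pi1 v) (@pi1_closed v).

Definition vcoset (x : path_group) (u : vertex Gam) : set path_group :=
  [set x * pg_v g | g in [set: vertex_group GG u]].

(* The endpoint [u] of an element of [path_set v u] is determined by the
   element, so cosets attached to different vertices are different subsets. *)
Definition bs_vertex_set (v : vertex Gam) : set (set path_group) :=
  [set A | exists u x, path_set v u x /\ A = vcoset x u].

Definition bs_vertex (v : vertex Gam) := {A | bs_vertex_set v A}.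

Definition bs_adj (v : vertex Gam) (A B : bs_vertex v) : Prop :=
  exists (e : edge Gam) (x y : path_group)
      (g : vertex_group GG (org e)) (h : vertex_group GG (trg e)),
    [/\ path_set v (org e) x, sval A = vcoset x (org e),
        path_set v (trg e) y, sval B = vcoset y (trg e)
      & x^-1 * y = pg_v g * pg_e e * pg_v h].

End PathGroup.

Record action (gT : groupType) (S : Type) := Action {
  act :> gT -> S -> S;
  act1 : forall x, act 1 x = x;
  actM : forall g h x, act (g * h) x = act g (act h x)
}.

Definition strongly_faithful (gT : groupType) (S : Type) (a : action gT S) :=
  forall F : set gT, finite_set F -> ~ F 1 ->
    exists x, forall g, F g -> a g x <> x.

Record adj_graph := AdjGraph {
  adj_vertex : Type;
  adj : adj_vertex -> adj_vertex -> Prop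
}.

Record graph_action (gT : groupType) (X : adj_graph) := GraphAction {
  vertex_action :> action gT (adj_vertex X);
  vertex_action_adj : forall g A B,
    adj A B -> adj (vertex_action g A) (vertex_action g B)
}.

Section BassSerre.
Variables (Gam : graph) (GG : graph_of_groups Gam) (v : vertex Gam).

Definition bass_serre_tree : adj_graph := AdjGraph (@bs_adj Gam GG v).

Definition translate (x : path_group GG) (A : set (path_group GG)) :=
  [set x * y | y in A].

Lemma translate_vcoset x y u : translate x (vcoset y u) = vcoset (x * y) u.
Proof.
apply/seteqP; split=> z.
  by case=> _ [g _ <-] <-; exists g => //; rewrite mulgA.
by case=> g _ <-; exists (y * pg_v g); [exists g | rewrite mulgA].
Qed.

Lemma bs_vertex_set_translate (x : pi1 GG v) A :
  bs_vertex_set v A -> bs_vertex_set v (translate (val x) A).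
Proof.
case=> u [y [yP ->]]; exists u, (val x * y); split.
  by apply: path_setM yP; have := valP x; rewrite in_setE.
exact: translate_vcoset.
Qed.

Definition bs_act (x : pi1 GG v) (A : adj_vertex bass_serre_tree) :
    adj_vertex bass_serre_tree :=
  exist _ (translate (val x) (sval A)) (bs_vertex_set_translate x (svalP A)).

Lemma bs_act1 A : bs_act 1 A = A.
Proof.
apply: sig_inj; apply/seteqP; split=> z /=.
  by case=> y Ay <-; rewrite mul1g.
by move=> Az; exists z => //; rewrite mul1g.
Qed.

Lemma bs_actM x y A : bs_act (x * y) A = bs_act x (bs_act y A).
Proof.
apply: sig_inj; apply/seteqP; split=> z /=.
  by case=> t At <-; exists (val y * t); [exists t | rewrite mulgA].
by case=> _ [t At <-] <-; exists t => //; rewrite mulgA.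
Qed.

Lemma bs_act_adj x A B : adj A B -> adj (bs_act x A) (bs_act x B).
Proof.
have xP : path_set v v (val x) by have := valP x; rewrite in_setE.
case=> e [y [z [g [h [yP Ay zP Bz E]]]]].
exists e, (val x * y), (val x * z), g, h; split.
- exact: path_setM yP.
- by rewrite /= Ay; exact: translate_vcoset.
- exact: path_setM zP.
- by rewrite /= Bz; exact: translate_vcoset.
- by rewrite invgM -mulgA mulKg.
Qed.

Definition bass_serre_action : graph_action (pi1 GG v) bass_serre_tree :=
  GraphAction (vertex_action := Action bs_act1 bs_actM) bs_act_adj.

End BassSerre.

(* Main.v *)
From HB Require Import structures.
From mathcomp Require Import all_boot.
From mathcomp Require Import boolp classical_sets functions cardinality.
Require Import Defs.

Set Implicit Arguments.
Unset Strict Implicit.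
Unset Printing Implicit Defensive.

Local Open Scope classical_set_scope.
Local Open Scope card_scope.
Local Open Scope group_scope.

(** The tree of the restriction [G'] sits inside the tree of [G], and a vertex
    of the smaller tree has no new stabilizer: if [g] in [pi_1(G, v)] fixes
    [y G_u] with [y] a path of [G'], then [y^-1 g y] lies in [G_u], so that
    [g] lies in [y G_u y^-1], which consists of elements of [pi_1(G', v)]
    ([stabilizer_sub_vcoset]). Given a finite set [F] of nontrivial elements of
    [pi_1(G, v)], strong faithfulness of the smaller action provides a vertex
    moved by those elements of [F] which come from [pi_1(G', v)]; the other
    elements of [F] fix no vertex of the smaller tree at all.

    What this argument rests on is the injectivity of the natural morphism
    [F(G') -> F(G)] of path groups ([sub_pg_inj]): it makes the preimage of
    [F] in [pi_1(G', v)] finite, and it ensures that the element of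
    [pi_1(G', v)] found to fix the vertex is the one known to move it.

    Injectivity is proved without normal forms. Two injective morphisms
    [a, b : H -> P] become conjugate in some group containing [P]: let [P] act
    on [P * (nat -> P)] by left translation of the first factor. Through [a] and
    through [b] the group [H] acts freely with equally many orbits, so these
    two actions are isomorphic, and an isomorphism is a permutation conjugating
    one to the other ([free_actions_conjugate]). Hence, once all vertex groups
    are embedded in a group [P], stable letters for the edges exist in a larger
    group, and may be prescribed beforehand on some of the edges
    ([path_group_realization]). Taking for [P] the product of the vertex groups
    and prescribing nothing shows that the vertex groups embed in the path
    group ([pg_v_inj]). Taking [P = F(G') * F(G)], a direct product, with the
    vertex groups and edges of [G'] placed in the first factor and the other
    vertex groups in the second, yields a morphism from [F(G)] to an overgroup
    of [F(G')] that restricts to the inclusion of [F(G')]. *)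

(** * Groups: morphisms, permutation groups, products *)

Lemma morph_mulg1 (G H : groupType) (f : G -> H) :
  {morph f : x y / x * y} -> f 1 = 1.
Proof. by move=> fM; apply: (@mulgI _ (f 1)); rewrite -fM !mulg1. Qed.

Lemma morph_mulgV (G H : groupType) (f : G -> H) :
  {morph f : x y / x * y} -> {morph f : x / x^-1}.
Proof.
move=> fM x; apply: (@mulgI _ (f x)).
by rewrite -fM !mulgV; exact: morph_mulg1.
Qed.

(** Each permutation carries its inverse, so that inversion needs no choice. *)
Record sym (T : Type) := Sym {
  sym_fun :> T -> T;
  sym_inv : T -> T;
  sym_funK : cancel sym_fun sym_inv;
  sym_invK : cancel sym_inv sym_fun
}.

Section SymGroup.
Variable T : Type.
Implicit Types s t : sym T.

HB.instance Definition _ := gen_eqMixin (sym T).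
HB.instance Definition _ := gen_choiceMixin (sym T).

Lemma symP s t : s =1 t -> s = t.
Proof.
case: s t => [f f' fK f'K] [g g' gK g'K] /= fg.
have ? : f = g by exact: funext.
subst g; have ? : f' = g' by apply: funext => x; rewrite -{1}[x]g'K fK.
by subst g'; congr Sym; exact: Prop_irrelevance.
Qed.

Definition sym_one : sym T := @Sym T id id (frefl _) (frefl _).
Definition sym_opp s : sym T := Sym (@sym_invK _ s) (@sym_funK _ s).
Definition sym_mul s t : sym T :=
  Sym (can_comp (@sym_funK _ s) (@sym_funK _ t))
      (can_comp (@sym_invK _ t) (@sym_invK _ s)).

Lemma sym_mulA : associative sym_mul. Proof. by move=> *; exact: symP. Qed.
Lemma sym_mul1 : left_id sym_one sym_mul. Proof. by move=> *; exact: symP. Qed.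
Lemma sym_mulx1 : right_id sym_one sym_mul.
Proof. by move=> *; exact: symP. Qed.
Lemma sym_mulV : left_inverse sym_one sym_opp sym_mul.
Proof. by move=> s; apply: symP; exact: sym_funK. Qed.
Lemma sym_mulxV : right_inverse sym_one sym_opp sym_mul.
Proof. by move=> s; apply: symP; exact: sym_invK. Qed.

HB.instance Definition _ := isGroup.Build (sym T)
  sym_mulA sym_mul1 sym_mulx1 sym_mulV sym_mulxV.

End SymGroup.

Section DepProduct.
Variables (I : Type) (G : I -> groupType).

Definition dprod := forall i, G i.
HB.instance Definition _ := Choice.on dprod.

Implicit Types f g : dprod.
Lemma dprodP f g : (forall i, f i = g i) -> f = g.
Proof. exact: functional_extensionality_dep. Qed.

Definition dprod_one : dprod := fun=> 1.
Definition dprod_mul f g : dprod := fun i => f i * g i.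
Definition dprod_inv f : dprod := fun i => (f i)^-1.

Lemma dprod_mulA : associative dprod_mul.
Proof. by move=> f g h; apply: dprodP => i; exact: mulgA. Qed.
Lemma dprod_mul1 : left_id dprod_one dprod_mul.
Proof. by move=> f; apply: dprodP => i; exact: mul1g. Qed.
Lemma dprod_mulx1 : right_id dprod_one dprod_mul.
Proof. by move=> f; apply: dprodP => i; exact: mulg1. Qed.
Lemma dprod_mulV : left_inverse dprod_one dprod_inv dprod_mul.
Proof. by move=> f; apply: dprodP => i; exact: mulVg. Qed.
Lemma dprod_mulxV : right_inverse dprod_one dprod_inv dprod_mul.
Proof. by move=> f; apply: dprodP => i; exact: mulgV. Qed.

HB.instance Definition _ := isGroup.Build dprod
  dprod_mulA dprod_mul1 dprod_mulx1 dprod_mulV dprod_mulxV.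

Definition dprod_inj (i : I) (x : G i) : dprod := fun k =>
  if pselect (i = k) is left ik then eq_rect i (fun k => G k : Type) x k ik
  else 1.

Lemma dprod_injM i : {morph @dprod_inj i : x y / x * y}.
Proof.
move=> x y; apply: dprodP => k.
rewrite /dprod_inj [RHS]/(dprod_mul _ _ k) /dprod_mul.
by case: pselect => [ik|_]; [case: k / ik | rewrite mulg1].
Qed.

Lemma dprod_inj_inj i : injective (@dprod_inj i).
Proof.
move=> x y /(congr1 (fun f => f i)); rewrite /dprod_inj.
by case: pselect => // ii; rewrite (Prop_irrelevance ii erefl).
Qed.

End DepProduct.

(** * Conjugating isomorphic subgroups in a larger group *)

Section Ample.
Variable P : groupType.

(** The second factor absorbs [P]: [P * (nat -> P)] is in bijection with
    [nat -> P]. This makes the number of orbits independent of the subgroup of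
    [P] that acts. *)
Definition ample := (P * (nat -> P))%type.

HB.instance Definition _ := Choice.on ample.
HB.instance Definition _ := isPointed.Build ample (1, fun=> 1).

Definition translate_by (p : P) (x : ample) : ample := (p * x.1, x.2).

Lemma translate_byK p : cancel (translate_by p) (translate_by p^-1).
Proof. by case=> q m; rewrite /translate_by /= mulKg. Qed.

Lemma translate_byVK p : cancel (translate_by p^-1) (translate_by p).
Proof. by case=> q m; rewrite /translate_by /= mulVKg. Qed.

Definition transl (p : P) : sym ample :=
  Sym (@translate_byK p) (@translate_byVK p).

Lemma translM : {morph transl : p q / p * q}.
Proof. by move=> p q; apply: symP => x /=; rewrite /translate_by /= mulgA. Qed.

Lemma transl_inj : injective transl.
Proof.
move=> p q /(congr1 (fun s : sym ample => (s (1, fun=> 1)).1)) /=.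
by rewrite !mulg1.
Qed.

(** Choose a representative in each right coset [a(H) p]; the orbits are
    parametrized by the pairs of a representative and a sequence. By
    Cantor-Bernstein there are exactly as many pairs as sequences, so the
    action is [H] times a set that does not depend on [a]. *)
Lemma ample_free_action (H : groupType) (a : H -> P) :
    {morph a : h k / h * k} -> injective a ->
  exists phi : H * (nat -> P) -> ample,
    bijective phi /\ forall h k m, phi (h * k, m) = transl (a h) (phi (k, m)).
Proof.
move=> aM a_inj.
pose coset (p : P) : set P := range (fun h => a h * p).
have cosetE h p : coset (a h * p) = coset p.
  apply/seteqP; split=> _ [k _ <-].
    by exists (k * h) => //; rewrite aM mulgA.
  by exists (k * h^-1) => //; rewrite mulgA -aM mulgVK.
pose r p : P := xget 1 (coset p).
have rP p : coset p (r p) by apply: xgetPex; exists (a 1 * p), 1.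
have rE h p : r (a h * p) = r p by rewrite /r cosetE.
have rr p : r (r p) = r p by have [h _ E] := rP p; rewrite -{1}E rE.
(* [R] meets each orbit of [H] on [ample] exactly once. *)
pose R : set ample := [set x | r x.1 = x.1].
have : [set: nat -> P] #= R.
  apply: Cantor_Bernstein.
    have [f] : $|{injfun [set: nat -> P] >-> R}|.
      apply/injfunPex; exists (fun m => (r 1, m)).
        by move=> m _; exact: rr.
      by move=> m n _ _ [].
    exact: inj_card_le f.
  have [f] : $|{injfun R >-> [set: nat -> P]}|.
    apply/injfunPex.
    (* Prepend the representative to the sequence. *)
    exists (fun x n => if n is n'.+1 then x.2 n' else x.1) => //.
    move=> [p m] [q n] _ _ /= E; congr (_, _); first exact: (congr1 (@^~ 0) E).
    by apply: funext => k; exact: (congr1 (@^~ k.+1) E).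
  exact: inj_card_le f.
move=> /card_set_bijP[be [beR be_inj be_surj]].
exists (fun x => transl (a x.1) (be x.2)); split; last first.
  by move=> h k m; rewrite aM translM.
rewrite -setTT_bijective; split=> //.
  move=> [h m] [k n] _ _ /= E.
  have mn : m = n.
    apply: be_inj; rewrite ?in_setT//.
    have := congr1 (fun x : ample => r x.1) E; rewrite /= !rE !beR//.
    move: (congr1 snd E) => /=.
    by case: (be m) (be n) => [? ?] [? ?] /= -> ->.
  congr (_, _) => //; apply: a_inj; apply: (@mulIg _ (be m).1).
  by have := congr1 fst E; rewrite /= -mn.
move=> [p q] _.
have [h _ hE] := rP p.
have [|m _ mE] := be_surj (r p, q); first exact: rr.
exists (h^-1, m) => //=; rewrite mE /translate_by /= -hE mulgA -aM mulVg.
by rewrite (morph_mulg1 aM) mul1g.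
Qed.

(** Both actions of [H] are isomorphic to the same model, and [c] is the
    composite of one isomorphism with the inverse of the other. *)
Lemma free_actions_conjugate (H : groupType) (a b : H -> P) :
    {morph a : h k / h * k} -> injective a ->
    {morph b : h k / h * k} -> injective b ->
  exists c : sym ample, forall h, c^-1 * transl (a h) * c = transl (b h).
Proof.
move=> aM a_inj bM b_inj.
have [phi [[phi' phiK phi'K] phiM]] := ample_free_action aM a_inj.
have [psi [[psi' psiK psi'K] psiM]] := ample_free_action bM b_inj.
pose c : sym ample := Sym (can_comp phiK psi'K) (can_comp psiK phi'K).
exists c => h; apply: (@mulgI _ c); rewrite mulgA mulVKg.
apply: symP => x; rewrite -[x]psi'K.
move: (psi' x) => [k m].
change (transl (a h) (phi (psi' (psi (k, m)))) =
        phi (psi' (transl (b h) (psi (k, m))))).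
by rewrite -psiM !psiK phiM.
Qed.

End Ample.

(** * Morphisms out of the path group *)

(** The defining relation of the path group at [e], for vertex groups mapped
    to [L] by [j] and edges by [t]. *)
Definition edge_conjugates (Gam : graph) (GG : graph_of_groups Gam)
    (L : groupType) (j : forall v, vertex_group GG v -> L) (t : edge Gam -> L)
    (e : edge Gam) :=
  forall g : edge_group GG e,
    (t e)^-1 * j _ (alpha GG e g) * t e = j _ (alpha GG (bar e) (edge_cast g)).

(** The path group is initial among the groups with such [j] and [t]. *)
Section Lift.
Variables (Gam : graph) (GG : graph_of_groups Gam) (L : groupType).
Variables (j : forall v, vertex_group GG v -> L) (t : edge Gam -> L).
Hypothesis jM : forall v, {morph @j v : x y / x * y}.
Hypothesis tV : forall e, t (bar e) = (t e)^-1.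
Hypothesis tj : forall e, edge_conjugates j t e.

Fixpoint pg_eval (x : pg_expr GG) : L :=
  match x with
  | PgVertex _ g => j g
  | PgEdge e => t e
  | PgOne => 1
  | PgMul x y => pg_eval x * pg_eval y
  | PgInv x => (pg_eval x)^-1
  end.

Lemma pg_eval_rel x y : pg_rel x y -> pg_eval x = pg_eval y.
Proof.
elim=> {x y} //=.
- by move=> x y z _ -> _ ->.
- by move=> x x' y y' _ -> _ ->.
- by move=> x x' _ ->.
- by move=> x y z; rewrite mulgA.
- by move=> x; rewrite mul1g.
- by move=> x; rewrite mulg1.
- by move=> x; rewrite mulVg.
- by move=> x; rewrite mulgV.
- by move=> e g; rewrite tV; exact: tj.
Qed.

Definition pg_lift (x : path_group GG) : L := pg_eval (repr x).

Lemma pg_liftE x : pg_lift (pg_class x) = pg_eval x.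
Proof. exact/pg_eval_rel/pg_repr. Qed.

Lemma pg_liftM : {morph pg_lift : x y / x * y}.
Proof. by move=> x y; rewrite [LHS]pg_liftE. Qed.

Lemma pg_lift_v v (g : vertex_group GG v) : pg_lift (pg_v g) = j g.
Proof. exact: pg_liftE. Qed.

Lemma pg_lift_e e : pg_lift (pg_e GG e) = t e.
Proof. exact: pg_liftE. Qed.

End Lift.

Lemma pg_morph_ext (Gam : graph) (GG : graph_of_groups Gam) (L : groupType)
    (f f' : path_group GG -> L) :
  {morph f : x y / x * y} -> {morph f' : x y / x * y} ->
  (forall v (g : vertex_group GG v), f (pg_v g) = f' (pg_v g)) ->
  (forall e, f (pg_e GG e) = f' (pg_e GG e)) -> f =1 f'.
Proof.
move=> fM f'M fv fe x; rewrite -(pg_reprK x).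
elim: (repr x) => [v g|e||y IHy z IHz|y IHy]; [exact: fv|exact: fe|..].
- by rewrite [pg_class _]/(1 : path_group GG) !morph_mulg1.
- by rewrite -pg_mulE -[pg_mul _ _]/(pg_class y * pg_class z) fM f'M IHy IHz.
- by rewrite -pg_invE -[pg_inv _]/((pg_class y)^-1) !morph_mulgV// IHy.
Qed.

(** * Realizing the edges of a graph of groups *)

Section Realize.
Variables (Gam : graph) (GG : graph_of_groups Gam).

Lemma edge_castM e : {morph @edge_cast Gam GG e : g h / g * h}.
Proof. by rewrite /edge_cast; case: _ / (edge_group_bar GG e). Qed.

Lemma edge_cast_inj e : injective (@edge_cast Gam GG e).
Proof. by rewrite /edge_cast; case: _ / (edge_group_bar GG e). Qed.

(** The identifications of [G_e] with [G_(bar e)] and of the latter with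
    [G_(bar (bar e))] compose to the transport along [barK e], because any two
    proofs of an equality between groups agree. The function [j] brings both
    sides, which lie in different vertex groups a priori, to one type. *)
Lemma alpha_edge_castK (L : Type) (j : forall v, vertex_group GG v -> L) e
    (g : edge_group GG e) :
  j _ (alpha GG (bar (bar e)) (edge_cast (edge_cast g))) = j _ (alpha GG e g).
Proof.
pose cast (A B : groupType) (AB : A = B) (x : A) : B :=
  eq_rect A (fun H : groupType => H : Type) x B AB.
have castK A B C (AB : A = B) (BC : B = C) x :
    cast B C BC (cast A B AB x) = cast A C (etrans AB BC) x.
  by case: C / BC; case: B / AB.
rewrite /edge_cast -!/(cast _ _ _ _) castK.
move: (etrans _ _) (barK e); move: (bar (bar e)) => e' E ee'.
by subst e'; rewrite (Prop_irrelevance E erefl).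
Qed.

(** This is what allows a stable letter to be chosen for only one of the two
    orientations of an edge. *)
Lemma edge_conjugates_bar (L : groupType) (j : forall v, vertex_group GG v -> L)
    (t : edge Gam -> L) e :
  t (bar e) = (t e)^-1 -> edge_conjugates j t e -> edge_conjugates j t (bar e).
Proof.
move=> tV te g.
have [h ->] : exists h : edge_group GG e, g = edge_cast h.
  rewrite /edge_cast; by case: _ / (edge_group_bar GG e) g => g; exists g.
rewrite (alpha_edge_castK j) -te tV invgK !mulgA.
by rewrite mulgK mulgV mul1g.
Qed.

(** Iterated HNN extension: an edge [e] outside of [S] gets as stable letter a
    permutation conjugating the two copies of its edge group in [P]. The group
    [L] is the group of permutations of [ample P], whichever edges are added,
    since all stable letters can be found there independently. *)
Lemma path_group_realization (P : groupType)
    (j : forall v, vertex_group GG v -> P) (S : set (edge Gam)) (t : edge Gam -> P) :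
    (forall v, {morph @j v : x y / x * y}) -> (forall v, injective (@j v)) ->
    (forall e, S e -> S (bar e)) ->
    (forall e, S e -> t (bar e) = (t e)^-1) ->
    (forall e, S e -> edge_conjugates j t e) ->
  exists (L : groupType) (i : P -> L) (f : path_group GG -> L),
    [/\ {morph i : x y / x * y}, injective i, {morph f : x y / x * y},
        forall v (g : vertex_group GG v), f (pg_v g) = i (j v g)
      & forall e, S e -> f (pg_e GG e) = i (t e)].
Proof.
move=> jM j_inj Sbar tV tj.
pose lj v (g : vertex_group GG v) := transl (j v g).
have /choice[c cP] (e : edge Gam) : exists c : sym (ample P),
    forall g : edge_group GG e,
      c^-1 * lj _ (alpha GG e g) * c = lj _ (alpha GG (bar e) (edge_cast g)).
  apply: free_actions_conjugate.
  - by move=> g h; rewrite gmulfM jM.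
  - by move=> g h /j_inj; exact: alpha_inj.
  - by move=> g h; rewrite edge_castM gmulfM jM.
  - by move=> g h /j_inj/alpha_inj; exact: edge_cast_inj.
(* An enumeration of the edges orients each of them. *)
have [f f_inj] : exists f : edge Gam -> nat, injective f.
  have /countable_injP[f f_inj] := countable_edge GG.
  by exists f => x y fxy; apply: f_inj; rewrite ?in_setE.
pose pos e := f e < f (bar e).
have pos_bar e : pos (bar e) = ~~ pos e.
  rewrite /pos barK -leqNgt ltn_neqAle.
  by case: eqP => //= /f_inj/bar_neq.
pose s e := if pselect (S e) then transl (t e) else
  if pos e then c e else (c (bar e))^-1.
have sV e : s (bar e) = (s e)^-1.
  rewrite /s; case: pselect => Se /=; case: pselect => Sbe //=.
  - by rewrite tV// (morph_mulgV (@translM P)).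
  - by have := Sbar _ Se; rewrite barK.
  - by have := Sbar _ Sbe.
  - by rewrite pos_bar; case: (pos e) => /=; rewrite ?barK ?invgK.
have sj_pos e : ~ S e -> pos e -> edge_conjugates lj s e.
  by move=> Se pe g; rewrite /s; case: pselect => //= _; rewrite pe.
have sj e : edge_conjugates lj s e.
  have [Se|Se] := pselect (S e).
    move=> g; rewrite /s; case: pselect => //= _.
    by rewrite -(morph_mulgV (@translM P)) -!(@translM P) tj.
  have [pe|npe] := boolP (pos e); first exact: sj_pos.
  have /edge_conjugates_bar : edge_conjugates lj s (bar e).
    apply: sj_pos; last by rewrite pos_bar.
    by move=> /Sbar; rewrite barK.
  by rewrite barK; apply; rewrite sV invgK.
have ljM v : {morph lj v : x y / x * y}.
  by move=> x y; rewrite /lj jM translM.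
exists (sym (ample P)), (@transl P), (pg_lift lj s); split=> //.
- exact: translM.
- exact: transl_inj.
- exact: pg_liftM.
- by move=> v g; rewrite pg_lift_v.
- by move=> e Se; rewrite pg_lift_e// /s; case: pselect.
Qed.

Lemma pg_v_inj v : injective (@pg_v Gam GG v).
Proof.
pose P := dprod (vertex_group GG); pose j := @dprod_inj _ (vertex_group GG).
have [] := @path_group_realization P j set0 (fun=> 1) => //.
- exact: dprod_injM.
- exact: dprod_inj_inj.
move=> L [i [f [_ i_inj _ fv _]]] g h gh.
by apply/(@dprod_inj_inj _ (vertex_group GG) v)/i_inj; rewrite -!fv gh.
Qed.

End Realize.

(** * The path group of a subgraph *)

Section Subgraph.
Variables (Gam : graph) (GG : graph_of_groups Gam) (S : subgraph Gam).
Hypothesis cS : connected S.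
Let GS := restrict GG cS.

Definition sub_pg : path_group GS -> path_group GG :=
  @pg_lift _ GS (path_group GG)
    (fun v g => @pg_v _ GG (sval v) g) (fun e => pg_e GG (sval e)).

Let sub_vM (v : vertex S) :
  {morph (fun g : vertex_group GS v => @pg_v _ GG (sval v) g) : x y / x * y}.
Proof. exact: (@pg_vM _ GG (sval v)). Qed.

Let sub_eV (e : edge S) : pg_e GG (sval (bar e)) = (pg_e GG (sval e))^-1.
Proof. exact: (@pg_e_bar _ GG (sval e)). Qed.

Let sub_ej (e : edge S) : edge_conjugates
  (fun v (g : vertex_group GS v) => @pg_v _ GG (sval v) g)
  (fun e : edge S => pg_e GG (sval e)) e.
Proof.
by move=> g; rewrite -pg_e_bar; exact: (@pg_e_alpha _ GG (sval e) g).
Qed.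

Lemma sub_pgM : {morph sub_pg : x y / x * y}.
Proof. exact: pg_liftM. Qed.

Lemma sub_pg_v (v : vertex S) (g : vertex_group GS v) :
  sub_pg (pg_v g) = @pg_v _ GG (sval v) g.
Proof. exact: pg_lift_v. Qed.

Lemma sub_pg_e (e : edge S) : sub_pg (pg_e GS e) = pg_e GG (sval e).
Proof. exact: pg_lift_e. Qed.

(** The smaller path group embeds in an overgroup by a morphism that factors
    through [sub_pg]. *)
Lemma sub_pg_inj : injective sub_pg.
Proof.
pose P := (path_group GS * path_group GG)%type.
(* [j] is injective by [pg_v_inj], used for both graphs of groups. *)
pose j v (g : vertex_group GG v) : P :=
  if pselect (sub_vertex S v) is left vS
  then (@pg_v _ GS (exist _ v vS) g, 1) else (1, pg_v g).
have jE (v : vertex S) (g : vertex_group GG (sval v)) :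
    j (sval v) g = (@pg_v _ GS v g, 1).
  rewrite /j; case: pselect => [vS|]; last by case; exact: (svalP v).
  by case: v vS g => v p /= vS g; rewrite (Prop_irrelevance vS p).
pose t e : P :=
  if pselect (sub_edge S e) is left eS then (pg_e GS (exist _ e eS), 1) else 1.
have tE (e : edge S) : t (sval e) = (pg_e GS e, 1).
  rewrite /t; case: pselect => [eS|]; last by case; exact: (svalP e).
  by case: e eS => e p /= eS; rewrite (Prop_irrelevance eS p).
have [|||||L [i [f [iM i_inj fM fv fe]]]] :=
    @path_group_realization _ GG P j (sub_edge S) t.
- move=> v g h; rewrite /j; case: pselect => [vS|_].
    by rewrite (@pg_vM _ GS) /= -[RHS]/(_, _) mulg1.
  by rewrite pg_vM -[RHS]/(_, _) mulg1.
- move=> v g h; rewrite /j; case: pselect => [vS|_] [].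
    exact: (@pg_v_inj _ GS).
  exact: pg_v_inj.
- exact: sub_bar.
- move=> e eS; rewrite (tE (exist _ e eS)).
  rewrite (tE (sg_bar (exist _ e eS))) pg_e_bar -[RHS]/(_, _).
  by rewrite invg1.
- move=> e eS g.
  have := @pg_e_alpha _ GS (exist _ e eS) g.
  rewrite pg_e_bar => E.
  rewrite (tE (exist _ e eS)) (jE (sg_org (exist _ e eS))).
  rewrite (jE (sg_org (sg_bar (exist _ e eS)))) -[RHS]/(_, _).
  by rewrite -E -[LHS]/(_, _) /= invg1 !mulg1.
have fE : f \o sub_pg =1 fun x => i (x, 1).
  apply: pg_morph_ext.
  - by move=> x y /=; rewrite sub_pgM fM.
  - by move=> x y; rewrite -iM; congr i; rewrite -[RHS]/(_, _) mulg1.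
  - by move=> v g; rewrite /= sub_pg_v fv jE.
  - by move=> e; rewrite /= sub_pg_e fe ?tE//; exact: (svalP e).
move=> x y xy; have := fE x; rewrite /= xy => fx.
by have /i_inj[] : i (x, 1) = i (y, 1) by rewrite -fx; exact: fE.
Qed.

(** * Stabilizers of vertices of the subtree *)

Lemma sub_path_set (v u : vertex S) (x : path_group GS) :
  path_set v u x -> path_set (sval v) (sval u) (sub_pg x).
Proof.
case=> p [g [pP ->]].
elim: p v pP => [|[e h] p IH] v /=.
  by move=> ->; rewrite /path_prod big_nil mul1g sub_pg_v; exact: path_set_v.
case=> <- /IH {}IH; rewrite /path_prod big_cons /= -!mulgA sub_pgM sub_pg_v.
apply: path_setM (path_set_v _) _; rewrite sub_pgM sub_pg_e.
by apply: path_setM IH; exact: path_set_e.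
Qed.

Lemma sub_pi1_subproof (v : vertex S) (x : pi1 GS v) :
  sub_pg (val x) \in path_set (sval v) (sval v).
Proof.
by rewrite in_setE; apply: sub_path_set; have := valP x; rewrite in_setE.
Qed.

Definition sub_pi1 (v : vertex S) (x : pi1 GS v) : pi1 GG (sval v) :=
  exist _ (sub_pg (val x)) (sub_pi1_subproof x).

Lemma sub_pi1_inj v : injective (@sub_pi1 v).
Proof. by move=> x y /(congr1 val) /sub_pg_inj/val_inj. Qed.

Lemma sub_pi1_1 v : @sub_pi1 v 1 = 1.
Proof. by apply: val_inj; exact: morph_mulg1 sub_pgM. Qed.

Definition sub_vcoset (v u : vertex S) (y : path_group GS)
    (yP : path_set v u y) : bs_vertex GG (sval v) :=
  exist _ (vcoset (sub_pg y) (sval u))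
    (ex_intro _ (sval u) (ex_intro _ (sub_pg y)
      (conj (sub_path_set yP) erefl))).

(** The coset equation [g y G_u = y G_u] in the larger path group gives
    [g = y k y^-1] with [k] in [G_u], an expression that makes sense in the
    smaller one. *)
Lemma stabilizer_sub_vcoset (v u : vertex S) (y : path_group GS)
    (yP : path_set v u y) (g : pi1 GG (sval v)) :
  bass_serre_action GG (sval v) g (sub_vcoset yP) = sub_vcoset yP ->
  exists h : pi1 GS v, sub_pi1 h = g /\
    translate (val h) (vcoset y u) = vcoset y u.
Proof.
move=> /(congr1 sval); rewrite /= translate_vcoset => gy.
have : vcoset (val g * sub_pg y) (sval u) (val g * sub_pg y).
  by exists 1 => //; rewrite pg_v1 mulg1.
rewrite gy => -[k _ gE].
pose h := y * @pg_v _ GS u k * y^-1.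
have hP : h \in path_set v v.
  rewrite in_setE; apply: path_setM (path_setV yP).
  by apply: path_setM yP _; exact: path_set_v.
exists (exist _ h hP); split.
  apply: val_inj; rewrite /= /h !sub_pgM (morph_mulgV sub_pgM) sub_pg_v gE.
  by rewrite mulgK.
rewrite translate_vcoset /= /h mulgVK.
apply/seteqP; split=> _ [l _ <-].
  by exists (k * l) => //; rewrite (@pg_vM _ GS) mulgA.
exists (k^-1 * l) => //.
by rewrite -mulgA -(@pg_vM _ GS) mulVKg.
Qed.

End Subgraph.

Theorem lemma3p25 (Gam : graph) (GG : graph_of_groups Gam)
    (Gam' : subgraph Gam) (cGam' : connected (graph_of_subgraph Gam'))
    (hE : exists e : edge Gam, sub_edge Gam' e)
    (v : vertex (graph_of_subgraph Gam')) :
  strongly_faithful (bass_serre_action (restrict GG cGam') v) ->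
  strongly_faithful (bass_serre_action GG (sval v)).
Proof.
move=> sf F Ffin F1.
have [||[A [u [y [yP AE]]]] x_moved] := sf (@sub_pi1 _ GG _ cGam' v @^-1` F).
- by apply: finite_preimage Ffin => x y _ _; exact: sub_pi1_inj.
- by rewrite /preimage /= sub_pi1_1.
exists (sub_vcoset yP) => g Fg /stabilizer_sub_vcoset[h [hg hA]].
apply: (x_moved h); first by rewrite /preimage /= hg.
by apply: sig_inj; rewrite /= AE.
Qed.
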